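(* Let $\rho_0:\mathbb{R}\to\mathbb{R}$ be smooth, non-negative, with compact support contained in $(0,\infty)$ and $\int_{\mathbb{R}}\rho_0(\xi)\,d\xi=1$, let $\Theta_0(\xi)=-\int_\xi^\infty\rho_0(\eta)\,d\eta$, and let $\Omega_0:\mathbb{R}\to\mathbb{R}$ be smooth, non-negative and compactly supported. Then the solution of the CKY-model $$\Omega_t+U\,\Omega_\xi=e^{\xi}\,\Theta_\xi,\qquad \Theta_t+U\,\Theta_\xi=0,\qquad U(\xi,t)=\frac{2}{\pi}\int_{-\infty}^{\xi}\Omega(\xi',t)\,d\xi',$$ with initial data $\Omega(\cdot,0)=\Omega_0$, $\Theta(\cdot,0)=\Theta_0$ develops a singularity in finite time; that is, there is no smooth solution $(\Omega,\Theta)$ with these initial data defined for all $t\ge0$.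
   Context: The unknowns are real-valued functions $\Omega(\xi,t)$, $\Theta(\xi,t)$, $\xi\in\mathbb{R}$, $t\ge0$. They arise from the CKY-model $\omega_t+u\omega_x=\theta_x$, $\theta_t+u\theta_x=0$, $u(x)=-\frac{2}{\pi}x\int_x^\infty\frac{\omega(y)}{y}\,dy$ on $x>0$ (with $\omega$ odd and $\theta$ even in $x$) by the change of variables $x=e^{-\xi}$, $U(\xi)=-u(x)/x$, $\Omega(\xi)=\omega(x)$, $\Theta(\xi)=-\theta(x)+\theta(0)$. Thus $\rho=\Theta_\xi$ and $\rho_0=\Theta_\xi(\cdot,0)$. A smooth solution on a time interval means a pair of $C^\infty$ functions satisfying the equations pointwise, with the initial data attained at $t=0$, such that on each compact time subinterval the supports of $\Omega(\cdot,t)$ and $\Theta_\xi(\cdot,t)$ lie in a common compact subset of $\mathbb{R}$. *)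

(* Defs.v *)
From Stdlib Require Import Reals.
From Coquelicot Require Import Coquelicot.

Open Scope R_scope.

Definition smooth (f : R -> R) : Prop :=
  forall (n : nat) (x : R), ex_derive_n f n x.

Definition support (f : R -> R) : R -> Prop :=
  adherence (fun x => f x <> 0).

(** [is_derive] with [locally t] restricted to [I]: the two-sided derivative at
    interior points of an interval [I], the one-sided one at its endpoints. *)
Definition is_derive_on (I : R -> Prop) (f : R -> R) (t l : R) : Prop :=
  filterdiff f (within I (locally t)) (fun h => scal h l).

(** [Ck_on I k f]: all partial derivatives of [f] of order at most [k], in any
    order of differentiation, exist and are jointly continuous on the slab
    [R * I], up to the boundary. The witnesses [f_xi], [f_t] are unique on the
    slab when [I] is a nondegenerate interval. *)
Fixpoint Ck_on (I : R -> Prop) (k : nat) (f : R -> R -> R) : Prop :=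
  continuous_on (fun p : R * R => I (snd p)) (fun p => f (fst p) (snd p)) /\
  match k with
  | O => True
  | S k' =>
      exists f_xi f_t : R -> R -> R,
        (forall xi t, I t ->
           is_derive (fun x => f x t) xi (f_xi xi t) /\
           is_derive_on I (fun s => f xi s) t (f_t xi t)) /\
        Ck_on I k' f_xi /\ Ck_on I k' f_t
  end.

Definition smooth_on (I : R -> Prop) (f : R -> R -> R) : Prop :=
  forall k : nat, Ck_on I k f.

Definition d_xi (f : R -> R -> R) (xi t : R) : R :=
  Derive (fun x => f x t) xi.

Definition cky_U (Omega : R -> R -> R) (xi t : R) : R :=
  2 / PI * RInt_gen (fun y => Omega y t) (Rbar_locally m_infty) (at_point xi).

(** [I] is meant to be an interval containing 0; the values of [Omega] and
    [Theta] at times outside [I] are irrelevant. *)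
Record cky_smooth_solution (I : R -> Prop) (Omega0 Theta0 : R -> R)
    (Omega Theta : R -> R -> R) : Prop := {
  cky_smooth_Omega : smooth_on I Omega;
  cky_smooth_Theta : smooth_on I Theta;
  cky_eq_Omega : forall xi t, I t ->
    exists Omega_t, is_derive_on I (fun s => Omega xi s) t Omega_t /\
      Omega_t + cky_U Omega xi t * d_xi Omega xi t = exp xi * d_xi Theta xi t;
  cky_eq_Theta : forall xi t, I t ->
    exists Theta_t, is_derive_on I (fun s => Theta xi s) t Theta_t /\
      Theta_t + cky_U Omega xi t * d_xi Theta xi t = 0;
  cky_init_Omega : forall xi, Omega xi 0 = Omega0 xi;
  cky_init_Theta : forall xi, Theta xi 0 = Theta0 xi;
  cky_support : forall a b, (forall t, a <= t <= b -> I t) ->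
    exists K : R -> Prop, compact K /\
      forall t, a <= t <= b ->
        included (support (fun xi => Omega xi t)) K /\
        included (support (fun xi => d_xi Theta xi t)) K
}.

(* Main.v *)
(** Put [c = 2 / PI], [q = - Theta] and choose [B] so large that on a given time
    interval [[0, T]] all supports lie in [(- B, B)]. The functional
    [y(t) = int_{-B}^{B} q] satisfies, after integrations by parts,
    [y' = c int Omega q] and
    [y'' = c^2 int Omega^2 q + c/2 int e^xi q^2 + c/2 e^{-B}].
    Since [q] is transported by [U] and [0 <= q <= 1] initially, this persists
    (energy estimate for the positive part). By Cauchy-Schwarz against
    [e^{-xi}], [int_0^B e^xi q^2 >= (int_0^B q)^2], and
    [int_0^B q >= y - B >= d > 0], where [d] comes from the gap between [0] and
    the support of [rho0]. Hence [y'' >= c/2 (y - B)^2] with [y'(0) >= 0], which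
    forces blow-up before a time depending only on [c] and [d]; taking [T] to
    be that time contradicts global existence. *)

Require Import Defs.
From Stdlib Require Import Reals Lra Classical.
From Coquelicot Require Import Coquelicot.
Open Scope R_scope.

(** * Differential inequalities *)

Lemma derive_ge0_nondecreasing (f f' : R -> R) (a b : R) :
  a <= b ->
  (forall t, a <= t <= b -> is_derive f t (f' t)) ->
  (forall t, a <= t <= b -> 0 <= f' t) ->
  f a <= f b.
Proof.
intros Hab Hd Hp.
destruct (MVT_gen f a b f') as [c [Hc E]].
- intros x; rewrite Rmin_left, Rmax_right by lra; intros Hx; apply Hd; lra.
- intros x; rewrite Rmin_left, Rmax_right by lra; intros Hx.
  apply continuity_pt_filterlim, (ex_derive_continuous f).
  exists (f' x); apply Hd; lra.
- rewrite Rmin_left, Rmax_right in Hc by lra.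
  assert (0 <= f' c * (b - a)) by (apply Rmult_le_pos; [apply Hp|]; lra).
  lra.
Qed.

(** By the integrating factor, [E t * exp (- M * t)] is non-increasing. *)
Lemma gronwall_nonpos (E E' : R -> R) (M T : R) :
  0 <= T ->
  (forall t, 0 <= t <= T -> is_derive E t (E' t)) ->
  (forall t, 0 <= t <= T -> E' t <= M * E t) ->
  E 0 <= 0 -> E T <= 0.
Proof.
intros HT HE HM H0.
assert (H : - (E 0 * exp (- M * 0)) <= - (E T * exp (- M * T))).
{ apply (derive_ge0_nondecreasing (fun t => - (E t * exp (- M * t)))
    (fun t => (M * E t - E' t) * exp (- M * t))); trivial.
  - intros t Ht. specialize (HE t Ht).
    auto_derive; [now exists (E' t)|].
    rewrite (is_derive_unique (fun x : R => E x) _ _ HE); ring.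
  - intros t Ht. apply Rmult_le_pos; [|left; apply exp_pos].
    specialize (HM t Ht); lra. }
rewrite Rmult_0_r, exp_0 in H.
apply Rnot_lt_le; intros HE'.
assert (0 < E T * exp (- M * T)) by (apply Rmult_lt_0_compat; [lra|apply exp_pos]).
lra.
Qed.

(** The order of quantifiers matters: [T] depends on [k] and [d] alone, so it can be fixed before
    the spatial window is chosen. Once [a >= 0] has given [p >= 0] and [v >= 0], multiplying
    [a >= k v^2] by [p] yields the energy bound [p >= m v^(3/2)], under which [1 / sqrt v] would
    reach 0 in finite time. *)
Lemma quadratic_second_derivative_blowup (k d : R) :
  0 < k -> 0 < d ->
  exists T, 0 < T /\ forall v p a : R -> R,
    v 0 = 0 -> 0 <= p 0 ->
    (forall t, 0 <= t <= T -> is_derive v t (p t)) ->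
    (forall t, 0 <= t <= T -> is_derive p t (a t)) ->
    (forall t, 0 <= t <= T -> 0 <= a t) ->
    (forall t, 0 <= t <= T -> 0 <= v t -> k * (v t + d) ^ 2 <= a t) ->
    False.
Proof.
intros Hk Hd.
set (m := sqrt (2 * k / 3)).
assert (Hm : 0 < m) by (apply sqrt_lt_R0; lra).
assert (Hmm : m * m = 2 * k / 3) by (apply sqrt_sqrt; lra).
(* From [a >= k d^2 = 2 c1] comes [v >= c1 t^2], hence [v >= c1] from time 1 on. *)
set (c1 := k * d ^ 2 / 2).
assert (Hc1 : 0 < c1).
{ unfold c1. assert (0 < d ^ 2) by (apply pow_lt; lra).
  assert (0 < k * d ^ 2) by (now apply Rmult_lt_0_compat). lra. }
assert (Hs1 : 0 < sqrt c1) by (now apply sqrt_lt_R0).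
(* Time 1 brings [v] up to [c1]. From then on [/ sqrt v], at most [/ sqrt c1] and decreasing at rate
   at least [m / 2], would vanish within [2 / m * / sqrt c1]. *)
exists (1 + 2 / m * / sqrt c1).
assert (HT1 : 0 < 2 / m * / sqrt c1).
{ apply Rmult_lt_0_compat; [apply Rdiv_lt_0_compat; lra|].
  now apply Rinv_0_lt_compat. }
set (T := 1 + 2 / m * / sqrt c1). split; [unfold T; lra|].
intros v p a Hv0 Hp0 Hv Hp Ha0 Ha.
assert (Pp0 : forall t, 0 <= t <= T -> 0 <= p t).
{ intros t Ht. apply Rle_trans with (1 := Hp0).
  apply (derive_ge0_nondecreasing p a); try lra; intros s Hs;
    [apply Hp|apply Ha0]; lra. }
assert (Pv0 : forall t, 0 <= t <= T -> 0 <= v t).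
{ intros t Ht. rewrite <- Hv0.
  apply (derive_ge0_nondecreasing v p); try lra; intros s Hs;
    [apply Hv|apply Pp0]; lra. }
assert (Pa : forall t, 0 <= t <= T -> 2 * c1 <= a t).
{ intros t Ht. apply Rle_trans with (2 := Ha t Ht (Pv0 t Ht)).
  specialize (Pv0 t Ht).
  replace (2 * c1) with (k * d ^ 2) by (unfold c1; field).
  apply Rmult_le_compat_l; [lra|]. apply pow_incr; lra. }
assert (Pp : forall t, 0 <= t <= T -> 2 * c1 * t <= p t).
{ intros t Ht.
  enough (p 0 - 2 * c1 * 0 <= p t - 2 * c1 * t) by lra.
  apply (derive_ge0_nondecreasing (fun s => p s - 2 * c1 * s) (fun s => a s - 2 * c1));
    try lra; intros s Hs.
  - assert (H : is_derive p s (a s)) by (apply Hp; lra).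
    auto_derive; [now exists (a s)|].
    rewrite (is_derive_unique (fun x : R => p x) _ _ H); ring.
  - assert (2 * c1 <= a s) by (apply Pa; lra). lra. }
assert (Pv : forall t, 0 <= t <= T -> c1 * t ^ 2 <= v t).
{ intros t Ht.
  enough (v 0 - c1 * 0 ^ 2 <= v t - c1 * t ^ 2) by lra.
  apply (derive_ge0_nondecreasing (fun s => v s - c1 * s ^ 2) (fun s => p s - 2 * c1 * s));
    try lra; intros s Hs.
  - assert (H : is_derive v s (p s)) by (apply Hv; lra).
    auto_derive; [now exists (p s)|].
    rewrite (is_derive_unique (fun x : R => v x) _ _ H); ring.
  - assert (2 * c1 * s <= p s) by (apply Pp; lra). lra. }
(* energy: [p ^ 2 - 2 k / 3 v ^ 3] is nondecreasing *)
assert (Pe : forall t, 0 <= t <= T -> m * m * v t ^ 3 <= p t ^ 2).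
{ intros t Ht.
  enough (p 0 ^ 2 - m * m * v 0 ^ 3 <= p t ^ 2 - m * m * v t ^ 3).
  { rewrite Hv0 in H. assert (0 <= p 0 ^ 2) by apply pow2_ge_0. lra. }
  apply (derive_ge0_nondecreasing (fun s => p s ^ 2 - m * m * v s ^ 3)
     (fun s => 2 * p s * (a s - k * v s ^ 2))); try lra; intros s Hs.
  - assert (H : is_derive v s (p s)) by (apply Hv; lra).
    assert (H' : is_derive p s (a s)) by (apply Hp; lra).
    auto_derive; [split; [now exists (a s)|split; [now exists (p s)|trivial]]|].
    rewrite (is_derive_unique (fun x : R => v x) _ _ H),
      (is_derive_unique (fun x : R => p x) _ _ H'), Hmm; field.
  - assert (Hs' : 0 <= s <= T) by lra.
    assert (H1 := Pp0 s Hs'). assert (H2 := Pv0 s Hs').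
    assert (H3 := Ha s Hs' H2).
    apply Rmult_le_pos; [lra|].
    assert (k * v s ^ 2 <= k * (v s + d) ^ 2).
    { apply Rmult_le_compat_l; [lra|]. apply pow_incr; lra. }
    lra. }
assert (Pv1 : forall t, 1 <= t <= T -> c1 <= v t).
{ intros t Ht. apply Rle_trans with (c1 * t ^ 2); [|apply Pv; lra].
  rewrite <- (Rmult_1_r c1) at 1. apply Rmult_le_compat_l; [lra|].
  rewrite <- (pow1 2). apply pow_incr; lra. }
assert (Pr : forall t, 1 <= t <= T -> m * (v t * sqrt (v t)) <= p t).
{ intros t Ht. assert (Ht' : 0 <= t <= T) by lra.
  assert (H1 := Pv1 t Ht).
  apply Rsqr_incr_0_var; [|now apply Pp0].
  rewrite !Rsqr_pow2. apply Rle_trans with (2 := Pe t Ht').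
  right.
  replace ((m * (v t * sqrt (v t))) ^ 2)
    with (m * m * v t ^ 2 * (sqrt (v t) * sqrt (v t))) by ring.
  rewrite sqrt_sqrt by lra. ring. }
(* Integrated form of the decay of [/ sqrt v] on [[1, T]]; the choice of [T] makes it contradict
   [/ sqrt (v T) > 0]. *)
assert (H : - / sqrt (v 1) - m / 2 * 1 <= - / sqrt (v T) - m / 2 * T).
{ assert (1 <= T) by (unfold T; lra).
  apply (derive_ge0_nondecreasing (fun s => - / sqrt (v s) - m / 2 * s)
     (fun s => p s / (2 * (v s * sqrt (v s))) - m / 2)); trivial.
  - intros s Hs. assert (Hs' : 0 <= s <= T) by lra.
    assert (Hvs := Hv s Hs'). assert (H1 := Pv1 s Hs).
    assert (0 < sqrt (v s)) by (apply sqrt_lt_R0; lra).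
    assert (Hq : sqrt (v s) * sqrt (v s) = v s) by (apply sqrt_sqrt; lra).
    auto_derive; [repeat split; [now exists (p s)| lra | lra]|].
    rewrite (is_derive_unique (fun x : R => v x) _ _ Hvs).
    set (q := sqrt (v s)) in *. rewrite <- Hq. field. lra.
  - intros s Hs. assert (H1 := Pv1 s Hs). assert (H2 := Pr s Hs).
    assert (0 < sqrt (v s)) by (apply sqrt_lt_R0; lra).
    assert (0 < v s * sqrt (v s)) by (apply Rmult_lt_0_compat; lra).
    assert (m / 2 <= p s / (2 * (v s * sqrt (v s)))); [|lra].
    apply Rmult_le_reg_r with (2 * (v s * sqrt (v s))); [lra|].
    unfold Rdiv at 2. rewrite Rmult_assoc, Rinv_l by lra. lra. }
assert (HT : 1 <= T) by (unfold T; lra).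
assert (H1 : / sqrt (v 1) <= / sqrt c1).
{ apply Rinv_le_contravar; trivial. apply sqrt_le_1_alt, Pv1; lra. }
assert (H2 : 0 < / sqrt (v T)).
{ apply Rinv_0_lt_compat, sqrt_lt_R0. assert (c1 <= v T) by (apply Pv1; lra). lra. }
assert (m / 2 * T = m / 2 + / sqrt c1) by (unfold T; field; lra).
lra.
Qed.

(** * Integrals depending on time *)

(** Time ranges over all of [R], so that derivatives are two-sided and integrals can be
    differentiated at [t = 0] as well. Solutions on [t >= 0] enter through an extension to the
    plane. *)
Record C1_plane (f fx ft : R -> R -> R) : Prop := {
  C1_dx : forall x t, is_derive (fun y => f y t) x (fx x t);
  C1_dt : forall x t, is_derive (f x) t (ft x t);
  C1_cont : forall x t, continuity_2d_pt f x t;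
  C1_cont_dx : forall x t, continuity_2d_pt fx x t;
  C1_cont_dt : forall x t, continuity_2d_pt ft x t
}.

Lemma continuity_2d_pt_slice (f : R -> R -> R) (x t : R) :
  continuity_2d_pt f x t -> continuous (fun y => f y t) x.
Proof.
intros H. apply continuity_pt_filterlim.
intros eps Heps. destruct (H (mkposreal eps Heps)) as [d Hd].
exists d; split; [apply cond_pos|].
intros y [_ Hy]. apply Hd; [exact Hy|].
rewrite Rminus_eq_0, Rabs_R0; apply cond_pos.
Qed.

Lemma continuity_2d_pt_swap (f : R -> R -> R) (x t : R) :
  continuity_2d_pt f x t -> continuity_2d_pt (fun s y => f y s) t x.
Proof.
intros H eps. destruct (H eps) as [d Hd].
exists d. intros u v Hu Hv. now apply Hd.
Qed.

Lemma ex_RInt_slice (f : R -> R -> R) (a b t : R) :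
  (forall x, continuity_2d_pt f x t) -> ex_RInt (fun x => f x t) a b.
Proof.
intros H. apply (ex_RInt_continuous (V := R_CompleteNormedModule)).
intros x _. now apply continuity_2d_pt_slice.
Qed.

Lemma is_derive_RInt_slice (f ft : R -> R -> R) (a b t : R) :
  (forall x s, is_derive (f x) s (ft x s)) ->
  (forall x s, continuity_2d_pt f x s) ->
  (forall x s, continuity_2d_pt ft x s) ->
  is_derive (fun s => RInt (fun x => f x s) a b) t (RInt (fun x => ft x t) a b).
Proof.
intros Hd Hf Hft.
rewrite (RInt_ext (fun x => ft x t) (fun x => Derive (fun s => f x s) t)).
2: { intros x _. symmetry. apply is_derive_unique, Hd. }
apply (is_derive_RInt_param (fun s x => f x s)).
- exists (mkposreal 1 Rlt_0_1). intros s _ x _. exists (ft x s). apply Hd.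
- intros x _.
  apply continuity_2d_pt_ext with (fun s y => ft y s).
  + intros s y. symmetry. apply is_derive_unique, Hd.
  + now apply continuity_2d_pt_swap.
- exists (mkposreal 1 Rlt_0_1). intros s _. now apply ex_RInt_slice.
Qed.

(** The form in which integration by parts is used below: the integrand is written as [h - g'], and
    the exact derivative leaves only boundary values of [g]. *)
Lemma RInt_sub_derive (h g g' : R -> R) (a b : R) :
  a <= b ->
  (forall x, a <= x <= b -> is_derive g x (g' x)) ->
  (forall x, a <= x <= b -> continuous g' x) ->
  (forall x, a <= x <= b -> continuous h x) ->
  RInt (fun x => h x - g' x) a b = RInt h a b - (g b - g a).
Proof.
intros Hab Hg Hg' Hh. apply is_RInt_unique.
apply (is_RInt_minus (V := R_NormedModule)).
- apply (RInt_correct (V := R_CompleteNormedModule)).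
  apply (ex_RInt_continuous (V := R_CompleteNormedModule)).
  rewrite Rmin_left, Rmax_right by lra. exact Hh.
- apply (is_RInt_derive (V := R_CompleteNormedModule) g);
    rewrite Rmin_left, Rmax_right by lra; assumption.
Qed.

(** Non-negativity squeezes the primitive [RInt f a y] between 0 and [RInt f a b], so it is constant
    on [(a, b)] and its derivative [f] vanishes there. *)
Lemma RInt_ge0_eq0 (f : R -> R) (a b : R) :
  (forall x, continuous f x) -> (forall x, 0 <= f x) ->
  RInt f a b <= 0 -> forall x, a < x < b -> f x = 0.
Proof.
intros Hf H0 HI x Hx.
assert (He : forall u v, ex_RInt f u v).
{ intros u v. apply (ex_RInt_continuous (V := R_CompleteNormedModule)). auto. }
assert (HP : forall u v, u <= v -> 0 <= RInt f u v).
{ intros u v Huv. apply RInt_ge_0; auto. }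
assert (Hz : forall y, a < y < b -> RInt f a y = 0).
{ intros y Hy.
  assert (HC := RInt_Chasles f a y b (He _ _) (He _ _)).
  assert (H1 := HP a y ltac:(lra)). assert (H2 := HP y b ltac:(lra)).
  unfold plus in HC; simpl in HC. lra. }
assert (Hd : is_derive (fun y => RInt f a y) x (f x)).
{ apply (is_derive_RInt (V := R_NormedModule) f) with (a := a).
  - exists (mkposreal 1 Rlt_0_1). intros y _.
    now apply (RInt_correct (V := R_CompleteNormedModule)).
  - apply Hf. }
rewrite <- (is_derive_unique _ _ _ Hd).
rewrite (Derive_ext_loc _ (fun _ => 0)); [apply Derive_const|].
assert (He0 : 0 < Rmin (x - a) (b - x)) by (apply Rmin_glb_lt; lra).
exists (mkposreal _ He0). intros y Hy. apply Hz.
change (Rabs (y - x) < Rmin (x - a) (b - x)) in Hy.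
assert (H1 := Rmin_l (x - a) (b - x)). assert (H2 := Rmin_r (x - a) (b - x)).
apply Rabs_def2 in Hy. lra.
Qed.

(** Squaring removes the corner of [Rmax 0]: at 0 the difference quotient is at most [Rabs h] in
    absolute value. This makes the energy of the maximum principle differentiable. *)
Lemma is_derive_sqr_pos_part (u : R) :
  is_derive (fun u => Rmax 0 u ^ 2) u (2 * Rmax 0 u).
Proof.
destruct (Rtotal_order u 0) as [Hu|[->|Hu]].
- rewrite Rmax_left by lra. apply is_derive_ext_loc with (fun _ => 0).
  + assert (H : 0 < - u) by lra. exists (mkposreal _ H). intros y Hy.
    change (Rabs (y - u) < - u) in Hy. apply Rabs_def2 in Hy.
    rewrite Rmax_left by lra. simpl; ring.
  + rewrite Rmult_0_r. apply (is_derive_const (V := R_NormedModule) 0).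
- rewrite Rmax_left by lra. apply is_derive_Reals.
  intros eps Heps. exists (mkposreal eps Heps). intros h Hh Hl. simpl in Hl.
  rewrite Rplus_0_l, (Rmax_left 0 0) by lra.
  replace ((Rmax 0 h ^ 2 - 0 ^ 2) / h - 2 * 0) with (Rmax 0 h ^ 2 / h) by (field; trivial).
  apply Rle_lt_trans with (2 := Hl).
  destruct (Rle_dec h 0).
  + rewrite Rmax_left by lra. replace (0 ^ 2 / h) with 0 by (field; trivial).
    rewrite Rabs_R0. apply Rabs_pos.
  + rewrite Rmax_right by lra. right. f_equal. field; trivial.
- rewrite Rmax_right by lra. apply is_derive_ext_loc with (fun u => u ^ 2).
  + exists (mkposreal _ Hu). intros y Hy.
    change (Rabs (y - u) < u) in Hy. apply Rabs_def2 in Hy.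
    rewrite Rmax_right by lra. simpl; ring.
  + auto_derive; trivial; ring.
Qed.

Lemma continuous_pos_part (u : R) : continuous (Rmax 0) u.
Proof.
apply continuity_pt_filterlim.
intros eps Heps. exists eps; split; trivial. intros y [_ Hy].
apply Rle_lt_trans with (2 := Hy). simpl. unfold Rdist, Rmax, Rabs.
repeat destruct Rle_dec; repeat destruct Rcase_abs; lra.
Qed.

(** * Maximum principle *)

(** Energy estimate: the integral [E] of [F = (Rmax 0 q)^2] over [[a, b]] starts at 0 and satisfies
    [E' <= M E], because integration by parts moves the space derivative from [F] onto [U].
    Gronwall's inequality then keeps [E] at 0. *)
Lemma transport_nonpos (a b T M : R) (q qx qt U Ux : R -> R -> R) :
  a < b -> 0 <= T ->
  C1_plane q qx qt ->
  (forall x t, a <= x <= b -> 0 <= t <= T -> is_derive (fun y => U y t) x (Ux x t)) ->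
  (forall x t, continuous (fun y => Ux y t) x) ->
  (forall x t, a <= x <= b -> 0 <= t <= T -> Ux x t <= M) ->
  (forall x t, a <= x <= b -> 0 <= t <= T -> qt x t = - (U x t * qx x t)) ->
  (forall t, 0 <= t <= T -> q a t <= 0) ->
  (forall t, 0 <= t <= T -> q b t <= 0) ->
  (forall x, a <= x <= b -> q x 0 <= 0) ->
  forall x t, a <= x <= b -> 0 <= t <= T -> q x t <= 0.
Proof.
intros Hab HT [Hqx Hqt Cq Cqx Cqt] HU CUx HM Heq Ha Hb H0.
set (F := fun x t => Rmax 0 (q x t) ^ 2).
set (Ft := fun x t => 2 * Rmax 0 (q x t) * qt x t).
set (Fx := fun x t => 2 * Rmax 0 (q x t) * qx x t).
assert (CP : forall x t, continuity_2d_pt (fun x t => Rmax 0 (q x t)) x t).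
{ intros x t. apply continuity_1d_2d_pt_comp; auto.
  apply continuity_pt_filterlim, continuous_pos_part. }
assert (CF : forall x t, continuity_2d_pt F x t).
{ intros x t. unfold F. apply continuity_2d_pt_mult; auto.
  apply continuity_2d_pt_mult; auto. apply continuity_2d_pt_const. }
assert (CFt : forall x t, continuity_2d_pt Ft x t).
{ intros x t. apply continuity_2d_pt_mult; auto.
  apply continuity_2d_pt_mult; auto. apply continuity_2d_pt_const. }
assert (CFx : forall x t, continuity_2d_pt Fx x t).
{ intros x t. apply continuity_2d_pt_mult; auto.
  apply continuity_2d_pt_mult; auto. apply continuity_2d_pt_const. }
assert (DFt : forall x t, is_derive (F x) t (Ft x t)).
{ intros x t. unfold F, Ft. rewrite Rmult_comm.
  apply (is_derive_comp (fun u => Rmax 0 u ^ 2) (q x)); [|apply Hqt].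
  apply is_derive_sqr_pos_part. }
assert (DFx : forall x t, is_derive (fun y => F y t) x (Fx x t)).
{ intros x t. unfold F, Fx. rewrite Rmult_comm.
  apply (is_derive_comp (fun u => Rmax 0 u ^ 2) (fun y => q y t)); [|apply Hqx].
  apply is_derive_sqr_pos_part. }
assert (F0 : forall x t, q x t <= 0 -> F x t = 0).
{ intros x t H. unfold F. rewrite Rmax_left by lra. ring. }
assert (PF : forall x t, 0 <= F x t) by (intros x t; apply pow2_ge_0).
assert (CU : forall x t, a <= x <= b -> 0 <= t <= T -> continuous (fun y => U y t) x).
{ intros x t Hx Ht. apply (ex_derive_continuous (fun y => U y t)).
  exists (Ux x t). now apply HU. }
assert (HE : forall t, 0 <= t <= T ->
  RInt (fun x => Ft x t) a b <= M * RInt (fun x => F x t) a b).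
{ intros t Ht.
  (* Here [F_t = - U F_x = U_x F - (U F)_x], and [F] vanishes at both endpoints, where [q <= 0]. *)
  rewrite (RInt_ext (fun x => Ft x t)
    (fun x => Ux x t * F x t - (Ux x t * F x t + U x t * Fx x t))).
  2: { intros x. rewrite Rmin_left, Rmax_right by lra. intros Hx.
       unfold Ft. rewrite Heq by lra. unfold Fx. simpl. ring. }
  rewrite (RInt_sub_derive (fun x => Ux x t * F x t) (fun x => U x t * F x t)).
  - rewrite (F0 b), (F0 a) by auto. rewrite !Rmult_0_r, Rminus_0_r, Rminus_0_r.
    rewrite <- (RInt_scal (V := R_CompleteNormedModule)) by now apply ex_RInt_slice.
    apply RInt_le; [lra| | |].
    + apply (ex_RInt_continuous (V := R_CompleteNormedModule)).
      intros x _. apply (continuous_mult (K := R_AbsRing)); auto.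
      now apply continuity_2d_pt_slice.
    + apply (ex_RInt_scal (V := R_CompleteNormedModule)). now apply ex_RInt_slice.
    + intros x Hx. apply Rmult_le_compat_r; auto. apply HM; lra.
  - lra.
  - intros x Hx.
    apply (is_derive_mult (K := R_AbsRing) (fun x => U x t) (fun x => F x t));
      auto. intros; apply Rmult_comm.
  - intros x Hx. apply (continuous_plus (V := R_NormedModule));
      apply (continuous_mult (K := R_AbsRing)); auto;
      now apply continuity_2d_pt_slice.
  - intros x Hx. apply (continuous_mult (K := R_AbsRing)); auto;
      now apply continuity_2d_pt_slice. }
intros x t Hx Ht.
(* A vanishing integral gives [F = 0] only on the open interval, so the endpoints are treated
   apart. *)
destruct (Req_dec x a) as [->|Hxa]; [now apply Ha|].
destruct (Req_dec x b) as [->|Hxb]; [now apply Hb|].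
assert (HI : RInt (fun x => F x t) a b <= 0).
{ apply (gronwall_nonpos (fun t => RInt (fun x => F x t) a b)
    (fun t => RInt (fun x => Ft x t) a b) M); try lra.
  - intros s _. now apply is_derive_RInt_slice.
  - intros s Hs. apply HE; lra.
  - rewrite (RInt_ext _ (fun _ => 0)).
    + rewrite (RInt_const (V := R_CompleteNormedModule)).
      unfold scal; simpl; unfold mult; simpl; lra.
    + intros y. rewrite Rmin_left, Rmax_right by lra. intros Hy.
      apply F0, H0; lra. }
assert (HF : F x t = 0).
{ apply (RInt_ge0_eq0 (fun x => F x t) a b); auto; [|lra].
  intros y; now apply continuity_2d_pt_slice. }
apply Rnot_lt_le; intros Hq.
unfold F in HF. rewrite Rmax_right in HF by lra.
assert (0 < q x t ^ 2) by (apply pow_lt; lra). lra.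
Qed.

(** Uniform continuity on the rectangle gives an [e] within which [f] varies by less than 1. Walking
    right from the edge [x = a] in steps of [e / 2], [f] gains at most 1 per step. The result will
    bound [U_x] in the maximum principle. *)
Lemma continuous_2d_bounded_of_left_zero (f : R -> R -> R) (a b c d : R) :
  a <= b ->
  (forall x t, continuity_2d_pt f x t) ->
  (forall t, c <= t <= d -> f a t = 0) ->
  exists M, forall x t, a <= x <= b -> c <= t <= d -> f x t <= M.
Proof.
intros Hab Hf H0.
destruct (uniform_continuity_2d f a b c d (fun x y _ _ => Hf x y)
  (mkposreal 1 Rlt_0_1)) as [[e He] H]. simpl in H.
assert (Hn : forall (n : nat) x t, a <= x <= b -> c <= t <= d ->
  x <= a + INR n * (e / 2) -> f x t <= INR n).
{ induction n as [|n IH]; intros x t Hx Ht Hxn.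
  - simpl in Hxn. replace x with a by lra. rewrite H0 by trivial. simpl; lra.
  - rewrite S_INR in *.
    set (y := Rmax a (x - e / 2)).
    assert (Hy : a <= y <= x /\ x - y < e /\ y <= a + INR n * (e / 2)).
    { assert (0 <= INR n * (e / 2)) by (apply Rmult_le_pos; [apply pos_INR|lra]).
      unfold y, Rmax; destruct Rle_dec; lra. }
    assert (Hf1 : f y t <= INR n) by (apply IH; lra).
    assert (Hf2 : Rabs (f x t - f y t) < 1).
    { apply H; try lra; [rewrite Rabs_pos_eq; lra|].
      rewrite Rminus_eq_0, Rabs_R0; lra. }
    apply Rabs_def2 in Hf2. lra. }
destruct (INR_unbounded ((b - a) / (e / 2))) as [n Hn'].
exists (INR n). intros x t Hx Ht. apply Hn; trivial.
assert ((b - a) / (e / 2) * (e / 2) <= INR n * (e / 2)).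
{ apply Rmult_le_compat_r; lra. }
replace ((b - a) / (e / 2) * (e / 2)) with (b - a) in H1 by (field; lra). lra.
Qed.

Lemma continuous_ex_RInt (f : R -> R) (a b : R) :
  (forall x, continuous f x) -> ex_RInt f a b.
Proof.
intros H. apply (ex_RInt_continuous (V := R_CompleteNormedModule)). auto.
Qed.

(** * The convex functional *)

(** Cauchy-Schwarz with the weight [exp (- x)], whose integral over [[0, B]] is below 1. With [l]
    the integral of [f], it comes from integrating [exp x * f^2 - 2 l f + l^2 * exp (- x) = exp (-
    x) * (exp x * f - l)^2 >= 0]. *)
Lemma sqr_RInt_le_RInt_exp_sqr (f : R -> R) (B : R) :
  0 <= B -> (forall x, continuous f x) ->
  RInt f 0 B ^ 2 <= RInt (fun x => exp x * f x ^ 2) 0 B.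
Proof.
intros HB Hf. set (l := RInt f 0 B).
assert (Hexp : forall x, continuous exp x).
{ intros x. apply (ex_derive_continuous exp). auto_derive; trivial. }
assert (Hsq : forall x, continuous (fun x => exp x * f x ^ 2) x).
{ intros x. apply (continuous_mult (K := R_AbsRing)); auto.
  apply (continuous_mult (K := R_AbsRing)); auto.
  apply (continuous_mult (K := R_AbsRing)); auto.
  apply continuous_const. }
assert (Hl : forall x, continuous (fun x => 2 * l * f x) x).
{ intros x. apply (continuous_mult (K := R_AbsRing)); auto. apply continuous_const. }
set (g := fun x => - (l ^ 2 * exp (- x))).
set (g' := fun x => l ^ 2 * exp (- x)).
assert (Hg : forall x, is_derive g x (g' x)).
{ intros x. unfold g, g'. auto_derive; trivial; ring. }
assert (Hg' : forall x, continuous g' x).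
{ intros x. apply (ex_derive_continuous g'). unfold g'. auto_derive; trivial. }
assert (HI : RInt (fun x => 2 * l * f x - g' x) 0 B = 2 * l * l - (g B - g 0)).
{ rewrite (RInt_sub_derive (fun x => 2 * l * f x) g g') by auto.
  f_equal. apply (RInt_scal (V := R_CompleteNormedModule)).
  now apply continuous_ex_RInt. }
apply Rle_trans with (RInt (fun x => 2 * l * f x - g' x) 0 B).
- rewrite HI. unfold g. rewrite Ropp_0, exp_0.
  assert (0 <= l ^ 2 * exp (- B)).
  { apply Rmult_le_pos; [apply pow2_ge_0|left; apply exp_pos]. }
  nra.
- apply RInt_le; trivial.
  + apply continuous_ex_RInt. intros x.
    apply (continuous_minus (V := R_NormedModule)); auto.
  + now apply continuous_ex_RInt.
  + intros x _. unfold g'.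
    assert (He : exp x * exp (- x) = 1) by (rewrite <- exp_plus, Rplus_opp_r; apply exp_0).
    assert (Hp := exp_pos (- x)).
    replace (exp x * f x ^ 2) with (2 * l * f x - l ^ 2 * exp (- x)
      + exp (- x) * (exp x * f x - l) ^ 2); [|].
    * assert (0 <= exp (- x) * (exp x * f x - l) ^ 2).
      { apply Rmult_le_pos; [lra|apply pow2_ge_0]. }
      lra.
    * replace (exp (- x) * (exp x * f x - l) ^ 2) with
        ((exp x * exp (- x)) * (exp x * f x ^ 2) - 2 * l * f x * (exp x * exp (- x))
          + l ^ 2 * exp (- x)) by ring.
      rewrite He. ring.
Qed.

(** [W] stands for [Omega] and [Q] for [- Theta], on a window whose ends lie outside the supports.
    The last bound is restricted to [B <= y], with [y] the integral of [Q], because the lower bound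
    [y - B] for the integral over [[0, B]] can be squared only when it is non-negative. *)
Lemma cky_functional_convex (c B T : R) (W Wx Wt Q Qx Qt : R -> R -> R) :
  0 < c -> 0 < B -> 0 <= T ->
  C1_plane W Wx Wt -> C1_plane Q Qx Qt ->
  (forall t, 0 <= t <= T -> W (- B) t = 0 /\ W B t = 0) ->
  (forall t, 0 <= t <= T -> Q (- B) t = 1 /\ Q B t = 0) ->
  (forall x, - B <= x <= B -> 0 <= W x 0) ->
  (forall x, - B <= x <= B -> 0 <= Q x 0 <= 1) ->
  (forall x t, - B <= x <= B -> 0 <= t <= T ->
    Wt x t = - (c * RInt (fun y => W y t) (- B) x * Wx x t) - exp x * Qx x t) ->
  (forall x t, - B <= x <= B -> 0 <= t <= T ->
    Qt x t = - (c * RInt (fun y => W y t) (- B) x * Qx x t)) ->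
  exists p a : R -> R,
    0 <= p 0 /\
    forall t, 0 <= t <= T ->
      is_derive (fun t => RInt (fun x => Q x t) (- B) B) t (p t) /\
      is_derive p t (a t) /\
      0 <= a t /\
      (B <= RInt (fun x => Q x t) (- B) B ->
       c / 2 * (RInt (fun x => Q x t) (- B) B - B) ^ 2 <= a t).
Proof.
intros Hc HB HT CW CQ HW HQ HW0 HQ0 EW EQ.
set (U := fun x t => c * RInt (fun y => W y t) (- B) x).
assert (DU : forall x t, is_derive (fun y => U y t) x (c * W x t)).
{ intros x t. apply (is_derive_scal (fun y => RInt (fun y => W y t) (- B) y)).
  apply (is_derive_RInt (V := R_NormedModule) (fun y => W y t)) with (a := - B).
  - exists (mkposreal 1 Rlt_0_1). intros y _.
    apply (RInt_correct (V := R_CompleteNormedModule)), ex_RInt_slice.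
    intros z; apply (C1_cont _ _ _ CW).
  - apply continuity_2d_pt_slice, (C1_cont _ _ _ CW). }
assert (U0 : forall t, U (- B) t = 0).
{ intros t. unfold U. rewrite RInt_point. apply Rmult_0_r. }
assert (EU : forall x t, U x t = c * RInt (fun y => W y t) (- B) x) by reflexivity.
clearbody U.
assert (SW : forall x t, continuous (fun y => W y t) x).
{ intros x t. apply continuity_2d_pt_slice, (C1_cont _ _ _ CW). }
assert (SWx : forall x t, continuous (fun y => Wx y t) x).
{ intros x t. apply continuity_2d_pt_slice, (C1_cont_dx _ _ _ CW). }
assert (SQ : forall x t, continuous (fun y => Q y t) x).
{ intros x t. apply continuity_2d_pt_slice, (C1_cont _ _ _ CQ). }
assert (SQx : forall x t, continuous (fun y => Qx y t) x).
{ intros x t. apply continuity_2d_pt_slice, (C1_cont_dx _ _ _ CQ). }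
assert (SU : forall x t, continuous (fun y => U y t) x).
{ intros x t. apply (ex_derive_continuous (fun y => U y t)).
  exists (c * W x t). apply DU. }
assert (Sexp : forall x, continuous exp x).
{ intros x. apply (ex_derive_continuous exp). auto_derive; trivial. }
assert (Sm : forall f g : R -> R, (forall x, continuous f x) ->
  (forall x, continuous g x) -> forall x, continuous (fun x => f x * g x) x).
{ intros f g Hf Hg x. now apply (continuous_mult (K := R_AbsRing)). }
assert (Sp : forall f g : R -> R, (forall x, continuous f x) ->
  (forall x, continuous g x) -> forall x, continuous (fun x => f x + g x) x).
{ intros f g Hf Hg x. now apply (continuous_plus (V := R_NormedModule)). }
assert (Sc : forall d : R, forall x : R, continuous (fun _ : R => d) x).
{ intros d x. apply continuous_const. }
(* As [U_x = c W], an upper bound on [W] is the constant required by the maximum principle. *)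
destruct (continuous_2d_bounded_of_left_zero W (- B) B 0 T) as [M HM].
{ lra. }
{ intros x t; apply (C1_cont _ _ _ CW). }
{ intros t Ht; now apply HW. }
assert (SUx : forall x t, continuous (fun y => c * W y t) x).
{ intros x t. apply Sm; auto. }
assert (HUM : forall x t, - B <= x <= B -> 0 <= t <= T -> c * W x t <= c * M).
{ intros x t Hx Ht. apply Rmult_le_compat_l; [lra|]. now apply HM. }
(* Both [- Q] and [Q - 1] are transported by [U] and are non-positive at time 0 and at the two ends
   of the window. *)
assert (HQ01 : forall x t, - B <= x <= B -> 0 <= t <= T -> 0 <= Q x t <= 1).
{ intros x t Hx Ht. destruct CQ as [D1 D2 C0 C1 C2]. split.
  - enough (- Q x t <= 0) by lra.
    apply (transport_nonpos (- B) B T (c * M) (fun x t => - Q x t)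
      (fun x t => - Qx x t) (fun x t => - Qt x t) U (fun x t => c * W x t)); auto; try lra.
    + split; intros; auto using continuity_2d_pt_opp;
        apply (is_derive_opp (V := R_NormedModule)); auto.
    + intros y s Hy Hs. rewrite EQ by trivial. rewrite EU; ring.
    + intros s Hs. destruct (HQ s Hs). lra.
    + intros s Hs. destruct (HQ s Hs). lra.
    + intros y Hy. specialize (HQ0 y Hy). lra.
  - enough (Q x t - 1 <= 0) by lra.
    apply (transport_nonpos (- B) B T (c * M) (fun x t => Q x t - 1)
      Qx Qt U (fun x t => c * W x t)); auto; try lra.
    + split; intros; auto.
      * rewrite <- (Rminus_0_r (Qx x0 t0)).
        apply (is_derive_minus (V := R_NormedModule)); auto.
        apply (is_derive_const (V := R_NormedModule)).
      * rewrite <- (Rminus_0_r (Qt x0 t0)).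
        apply (is_derive_minus (V := R_NormedModule)); auto.
        apply (is_derive_const (V := R_NormedModule)).
      * apply continuity_2d_pt_minus; auto using continuity_2d_pt_const.
    + intros y s Hy Hs. now rewrite EQ, EU by trivial.
    + intros s Hs. destruct (HQ s Hs). lra.
    + intros s Hs. destruct (HQ s Hs). lra.
    + intros y Hy. specialize (HQ0 y Hy). lra. }
(* [p] is [y'] after integrating [- U Q_x] by parts; [a] is the derivative of [p] taken under the
   integral sign. *)
exists (fun t => c * RInt (fun x => W x t * Q x t) (- B) B).
exists (fun t => c * RInt (fun x => Wt x t * Q x t + W x t * Qt x t) (- B) B).
split.
{ apply Rmult_le_pos; [lra|]. apply RInt_ge_0; [lra| |].
  - apply continuous_ex_RInt, Sm; auto.
  - intros x Hx. apply Rmult_le_pos; [apply HW0|apply HQ0]; lra. }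
intros t Ht. split; [|split].
- replace (c * RInt (fun x => W x t * Q x t) (- B) B)
    with (RInt (fun x => Qt x t) (- B) B).
  { destruct CQ. now apply is_derive_RInt_slice. }
  rewrite (RInt_ext (fun x => Qt x t)
    (fun x => c * W x t * Q x t - (c * W x t * Q x t + U x t * Qx x t))).
  2: { intros x. rewrite Rmin_left, Rmax_right by lra. intros Hx.
       rewrite EQ, EU by lra. simpl. ring. }
  (* No boundary term survives: [U] vanishes at [- B] and [Q] at [B]. *)
  rewrite (RInt_sub_derive (fun x => c * W x t * Q x t) (fun x => U x t * Q x t)).
  + rewrite U0, (proj2 (HQ t Ht)), Rmult_0_r, Rmult_0_l, !Rminus_0_r.
    rewrite <- (RInt_scal (V := R_CompleteNormedModule))
      by (apply continuous_ex_RInt, Sm; auto).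
    apply RInt_ext. intros x _. unfold scal; simpl; unfold mult; simpl. ring.
  + lra.
  + intros x _. apply (is_derive_mult (K := R_AbsRing) (fun x => U x t) (fun x => Q x t)).
    * apply DU.
    * apply (C1_dx _ _ _ CQ).
    * intros; apply Rmult_comm.
  + intros x _. apply Sp; repeat apply Sm; auto.
  + intros x _. repeat apply Sm; auto.
- apply (is_derive_scal (fun t => RInt (fun x => W x t * Q x t) (- B) B)).
  destruct CW, CQ. apply (is_derive_RInt_slice (fun x t => W x t * Q x t)
    (fun x t => Wt x t * Q x t + W x t * Qt x t)); intros x s.
  + apply (is_derive_mult (K := R_AbsRing) (W x) (Q x)); auto.
    intros; apply Rmult_comm.
  + now apply continuity_2d_pt_mult.
  + apply continuity_2d_pt_plus; now apply continuity_2d_pt_mult.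
(* By the equations, [h - g'] is the integrand of [a / c]: in [g] the flux [U W Q] accounts for the
   transport and [exp x * Q^2 / 2] for the forcing [- exp x * Q Q_x]. Since [Q = 1] at [- B], the
   only boundary contribution is the positive [exp (- B) / 2]. *)
- set (h := fun x => c * W x t * (W x t * Q x t) + / 2 * (exp x * Q x t ^ 2)).
  set (g := fun x => U x t * (W x t * Q x t) + / 2 * (exp x * Q x t ^ 2)).
  set (g' := fun x => c * W x t * (W x t * Q x t)
    + U x t * (Wx x t * Q x t + W x t * Qx x t)
    + / 2 * (exp x * Q x t ^ 2 + exp x * (2 * Qx x t * Q x t))).
  assert (Ch : forall x, continuous h x).
  { apply Sp; repeat apply Sm; auto. }
  assert (Cg' : forall x, continuous g' x).
  { repeat first [apply Sp | apply Sm | auto]. }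
  assert (Dg : forall x, is_derive g x (g' x)).
  { intros x. assert (H1 := DU x t). assert (H2 := C1_dx _ _ _ CW x t).
    assert (H3 := C1_dx _ _ _ CQ x t).
    unfold g. auto_derive.
    - repeat split; trivial; eexists; eassumption.
    - rewrite (is_derive_unique (fun y : R => U y t) _ _ H1),
        (is_derive_unique (fun y : R => W y t) _ _ H2),
        (is_derive_unique (fun y : R => Q y t) _ _ H3).
      unfold g'. field. }
  assert (HI : RInt (fun x => Wt x t * Q x t + W x t * Qt x t) (- B) B
    = RInt h (- B) B + / 2 * exp (- B)).
  { rewrite (RInt_ext _ (fun x => h x - g' x)).
    2: { intros x. rewrite Rmin_left, Rmax_right by lra. intros Hx.
         rewrite EQ, EW by lra. unfold h, g'. rewrite EU. simpl. field. }
    rewrite (RInt_sub_derive h g g') by (auto; lra).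
    unfold g. rewrite U0, (proj2 (HQ t Ht)), (proj1 (HQ t Ht)). simpl. ring. }
  set (l := RInt (fun x => Q x t) 0 B).
  assert (Hh0 : forall x, - B <= x <= B -> / 2 * (exp x * Q x t ^ 2) <= h x).
  { intros x Hx. unfold h.
    assert (0 <= c * (W x t ^ 2 * Q x t)).
    { apply Rmult_le_pos; [lra|]. apply Rmult_le_pos; [apply pow2_ge_0|].
      now apply HQ01. }
    lra. }
  assert (Hsq : forall x, 0 <= / 2 * (exp x * Q x t ^ 2)).
  { intros x. apply Rmult_le_pos; [lra|].
    apply Rmult_le_pos; [left; apply exp_pos|apply pow2_ge_0]. }
  (* Two non-negative quantities are dropped: the term [c W^2 Q] and the integral of [h] over
     [[- B, 0]]. *)
  assert (Hl : l ^ 2 <= 2 * RInt h (- B) B).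
  { apply Rle_trans with (1 := sqr_RInt_le_RInt_exp_sqr (fun x => Q x t) B
      (Rlt_le _ _ HB) (fun x => SQ x t)).
    rewrite <- (RInt_Chasles (V := R_CompleteNormedModule) h (- B) 0 B)
      by now apply continuous_ex_RInt.
    assert (0 <= RInt h (- B) 0).
    { apply RInt_ge_0; [lra|now apply continuous_ex_RInt|].
      intros x Hx. apply Rle_trans with (1 := Hsq x). apply Hh0; lra. }
    assert (/ 2 * RInt (fun x => exp x * Q x t ^ 2) 0 B <= RInt h 0 B).
    { rewrite <- (RInt_scal (V := R_CompleteNormedModule))
        by (apply continuous_ex_RInt; repeat apply Sm; auto).
      apply RInt_le; [lra| |now apply continuous_ex_RInt|].
      - apply continuous_ex_RInt. repeat apply Sm; auto.
      - intros x Hx. apply Hh0; lra. }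
    unfold plus; cbn -[pow RInt]. lra. }
  (* Since [Q <= 1], the interval [[- B, 0]] contributes at most [B]. *)
  assert (HyB : RInt (fun x => Q x t) (- B) B - B <= l).
  { rewrite <- (RInt_Chasles (V := R_CompleteNormedModule) (fun x => Q x t) (- B) 0 B)
      by (apply continuous_ex_RInt; auto).
    assert (RInt (fun x => Q x t) (- B) 0 <= RInt (fun _ => 1) (- B) 0).
    { apply RInt_le; [lra|apply continuous_ex_RInt; auto..|].
      intros x Hx. apply HQ01; lra. }
    rewrite (RInt_const (V := R_CompleteNormedModule)) in H.
    unfold scal in H; simpl in H; unfold mult in H; simpl in H.
    unfold plus; simpl. fold l. lra. }
  rewrite HI. assert (He := exp_pos (- B)).
  assert (0 <= l ^ 2) by apply pow2_ge_0.
  split.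
  + apply Rmult_le_pos; lra.
  + intros Hy. unfold Rdiv. rewrite Rmult_assoc.
    apply Rmult_le_compat_l; [lra|].
    assert ((RInt (fun x => Q x t) (- B) B - B) ^ 2 <= l ^ 2).
    { apply pow_incr; lra. }
    lra.
Qed.

(** * One-sided time derivatives *)

Lemma is_derive_on_ge0_eps (f : R -> R) (t l : R) :
  is_derive_on (fun t => 0 <= t) f t l ->
  forall eps : posreal, exists d : posreal, forall s,
    0 <= s -> Rabs (s - t) < d ->
    Rabs (f s - f t - (s - t) * l) <= eps * Rabs (s - t).
Proof.
intros [_ H] eps.
destruct (H t (fun P HP => filter_le_within _ P HP) eps) as [d Hd].
exists d. intros s Hs Hst. exact (Hd s Hst Hs).
Qed.

(** Only forward increments [h > 0] are tested, since these are available even at [t = 0]; tolerance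
    [Rabs (l1 - l2) / 4] for each derivative is contradictory. This identifies the time derivatives
    given existentially in the equations with those of an extension. *)
Lemma is_derive_on_ge0_unique (f : R -> R) (t l1 l2 : R) :
  0 <= t ->
  is_derive_on (fun t => 0 <= t) f t l1 ->
  is_derive_on (fun t => 0 <= t) f t l2 -> l1 = l2.
Proof.
intros Ht H1 H2. apply Rminus_diag_uniq. apply NNPP; intros Hn.
assert (He : 0 < Rabs (l1 - l2) / 4) by (assert (H := Rabs_pos_lt _ Hn); lra).
destruct (is_derive_on_ge0_eps _ _ _ H1 (mkposreal _ He)) as [d1 Hd1].
destruct (is_derive_on_ge0_eps _ _ _ H2 (mkposreal _ He)) as [d2 Hd2].
assert (Hd : 0 < Rmin d1 d2) by (apply Rmin_glb_lt; apply cond_pos).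
set (h := Rmin d1 d2 / 2).
assert (Hh : 0 < h /\ h < d1 /\ h < d2).
{ assert (H3 := Rmin_l d1 d2). assert (H4 := Rmin_r d1 d2). unfold h; lra. }
assert (Hs : t + h - t = h) by ring.
specialize (Hd1 (t + h)). specialize (Hd2 (t + h)).
rewrite Hs, (Rabs_pos_eq h) in Hd1, Hd2 by lra. simpl in Hd1, Hd2.
specialize (Hd1 ltac:(lra) ltac:(lra)). specialize (Hd2 ltac:(lra) ltac:(lra)).
assert (H5 := Rabs_triang (f (t + h) - f t - h * l2) (- (f (t + h) - f t - h * l1))).
rewrite Rabs_Ropp in H5.
replace (f (t + h) - f t - h * l2 + - (f (t + h) - f t - h * l1))
  with (h * (l1 - l2)) in H5 by ring.
rewrite Rabs_mult, (Rabs_pos_eq h) in H5 by lra.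
assert (0 < h * Rabs (l1 - l2)) by (apply Rmult_lt_0_compat; lra).
lra.
Qed.

(** The time change [s] is non-expansive and lands in the half-line. It will be [Rmax 0 t],
    [Rmax 0 (- t)], the constant 0 or [Rabs t]. *)
Lemma continuity_2d_pt_half_plane (f : R -> R -> R) (s : R -> R) :
  continuous_on (fun p : R * R => 0 <= snd p) (fun p => f (fst p) (snd p)) ->
  (forall t, 0 <= s t) -> (forall t u, Rabs (s u - s t) <= Rabs (u - t)) ->
  forall x t, continuity_2d_pt (fun x t => f x (s t)) x t.
Proof.
intros Hf Hs0 Hs x t eps.
assert (HL : locally (f x (s t)) (fun z => Rabs (z - f x (s t)) < eps)).
{ exists eps. intros z Hz. exact Hz. }
destruct (Hf (x, s t) (Hs0 t) _ HL) as [d Hd].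
exists d. intros u v Hu Hv. apply (Hd (u, s v)).
- split; [exact Hu|]. exact (Rle_lt_trans _ _ _ (Hs t v) Hv).
- apply Hs0.
Qed.

(* The extension to [t < 0] is the odd reflection [2 f(x, 0) - f(x, - t)]; its
   [t]-derivative is the even reflection of that of [f]. *)
Lemma C1_plane_extension (f : R -> R -> R) :
  Ck_on (fun t => 0 <= t) 1 f ->
  exists g gx gt : R -> R -> R, C1_plane g gx gt /\
    forall x t, 0 <= t ->
      g x t = f x t /\ gx x t = d_xi f x t /\
      is_derive_on (fun t => 0 <= t) (f x) t (gt x t).
Proof.
intros [Cf [fx [ft [Df [[Cfx _] [Cft _]]]]]].
(* For [t >= 0] the last two terms cancel; for [t <= 0] the first equals [h x 0]. A single formula
   for both cases reduces continuity to three time changes. *)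
set (refl := fun (h : R -> R -> R) x t => h x (Rmax 0 t) + h x 0 - h x (Rmax 0 (- t))).
assert (Hrefl : forall h x t, 0 <= t -> refl h x t = h x t).
{ intros h x t Ht. unfold refl.
  rewrite Rmax_right, Rmax_left by lra. ring. }
assert (Crefl : forall h,
  continuous_on (fun p : R * R => 0 <= snd p) (fun p => h (fst p) (snd p)) ->
  forall x t, continuity_2d_pt (refl h) x t).
{ intros h Ch x t. apply continuity_2d_pt_minus; [apply continuity_2d_pt_plus|];
    apply (continuity_2d_pt_half_plane h); trivial.
  - intros; apply Rmax_l.
  - intros u v. unfold Rmax, Rabs.
    repeat destruct Rle_dec; repeat destruct Rcase_abs; lra.
  - intros; lra.
  - intros u v. rewrite Rminus_eq_0, Rabs_R0. apply Rabs_pos.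
  - intros; apply Rmax_l.
  - intros u v. unfold Rmax, Rabs.
    repeat destruct Rle_dec; repeat destruct Rcase_abs; lra. }
exists (refl f), (refl fx), (fun x t => ft x (Rabs t)).
split; [split|].
- intros x t. unfold refl.
  apply (is_derive_minus (V := R_NormedModule));
    [apply (is_derive_plus (V := R_NormedModule))|]; apply Df;
    try apply Rmax_l; lra.
- intros x t. apply is_derive_Reals.
  intros eps Heps. assert (He : 0 < eps / 2) by lra.
  destruct (is_derive_on_ge0_eps _ _ _ (proj2 (Df x (Rabs t) (Rabs_pos t)))
    (mkposreal _ He)) as [d Hd].
  (* For [t <> 0] the increment is kept below [Rabs t], so that [t] and [t + h] lie on the same side
     of 0 and one branch of the reflection applies. From [t = 0] every increment stays on one
     side. *)
  assert (Hd' : 0 < if Req_dec_T t 0 then pos d else Rmin d (Rabs t)).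
  { destruct Req_dec_T; [apply cond_pos|].
    apply Rmin_glb_lt; [apply cond_pos|now apply Rabs_pos_lt]. }
  exists (mkposreal _ Hd'). intros h Hh0 Hh. simpl in Hh.
  assert (Hsgn : Rabs h < d /\ (0 <= t /\ 0 <= t + h \/ t <= 0 /\ t + h <= 0)).
  { destruct Req_dec_T as [->|Ht].
    - split; trivial. lra.
    - assert (H1 := Rmin_l d (Rabs t)). assert (H2 := Rmin_r d (Rabs t)).
      split; [lra|].
      assert (H3 : Rabs h < Rabs t) by lra. revert H3.
      unfold Rabs. repeat destruct Rcase_abs; lra. }
  destruct Hsgn as [Hhd Hsgn].
  assert (Habs : Rabs (Rabs (t + h) - Rabs t) = Rabs h).
  { unfold Rabs. repeat destruct Rcase_abs; lra. }
  specialize (Hd (Rabs (t + h)) (Rabs_pos _)). rewrite Habs in Hd.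
  specialize (Hd Hhd). simpl in Hd.
  assert (HE : Rabs (refl f x (t + h) - refl f x t - h * ft x (Rabs t)) <= eps / 2 * Rabs h).
  { apply Rle_trans with (2 := Hd). right. unfold refl.
    destruct Hsgn as [[H1 H2]|[H1 H2]].
    - rewrite (Rmax_right 0 (t + h)), (Rmax_left 0 (- (t + h))),
        (Rmax_right 0 t), (Rmax_left 0 (- t)) by lra.
      rewrite !(Rabs_pos_eq t), !(Rabs_pos_eq (t + h)) by lra.
      f_equal; ring.
    - rewrite (Rmax_left 0 (t + h)), (Rmax_right 0 (- (t + h))),
        (Rmax_left 0 t), (Rmax_right 0 (- t)) by lra.
      rewrite !(Rabs_left1 t), !(Rabs_left1 (t + h)) by lra.
      rewrite <- Rabs_Ropp. f_equal; ring. }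
  replace ((refl f x (t + h) - refl f x t) / h - ft x (Rabs t))
    with ((refl f x (t + h) - refl f x t - h * ft x (Rabs t)) / h) by (field; trivial).
  assert (Hh' := Rabs_pos_lt _ Hh0).
  unfold Rdiv. rewrite Rabs_mult, Rabs_inv.
  apply Rmult_lt_reg_r with (Rabs h); trivial.
  rewrite Rmult_assoc, Rinv_l, Rmult_1_r by lra.
  apply Rle_lt_trans with (1 := HE). apply Rmult_lt_compat_r; lra.
- now apply Crefl.
- now apply Crefl.
- apply (continuity_2d_pt_half_plane ft Rabs Cft).
  + apply Rabs_pos.
  + intros t u. apply Rabs_triang_inv2.
- intros x t Ht. rewrite !Hrefl by trivial. split; [trivial|split].
  + symmetry. apply is_derive_unique, Df, Ht.
  + rewrite Rabs_pos_eq by trivial. now apply Df.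
Qed.

(** * Compact supports *)

(** With arbitrary filters at both ends, one argument covers the total mass, the tail integral
    defining [Theta0] and the velocity; at an [at_point] end the tail is an integral over a single
    point. *)
Lemma is_RInt_gen_zero_tails (f : R -> R) (a b : R) (F G : (R -> Prop) -> Prop) :
  Filter F -> Filter G ->
  F (fun u => is_RInt f u a 0) -> G (fun v => is_RInt f b v 0) ->
  ex_RInt f a b -> is_RInt_gen f F G (RInt f a b).
Proof.
intros FF FG HF HG Hf P HP.
apply (Filter_prod _ _ _ _ _ HF HG). intros u v Hu Hv.
exists (RInt f a b). split; [|now apply locally_singleton].
simpl. replace (RInt f a b) with (plus (plus 0 (RInt f a b)) 0)
  by (unfold plus; simpl; ring).
apply (is_RInt_Chasles (V := R_NormedModule)) with b; trivial.
apply (is_RInt_Chasles (V := R_NormedModule)) with a; trivial.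
now apply (RInt_correct (V := R_CompleteNormedModule)).
Qed.

Lemma is_RInt_zero (f : R -> R) (a b : R) :
  (forall x, Rmin a b < x < Rmax a b -> f x = 0) -> is_RInt f a b 0.
Proof.
intros H. apply is_RInt_ext with (fun _ => 0); [intros x Hx; symmetry; auto|].
assert (Hc := is_RInt_const (V := R_NormedModule) a b 0).
unfold scal in Hc; simpl in Hc; unfold mult in Hc; simpl in Hc.
now rewrite Rmult_0_r in Hc.
Qed.

Lemma left_tail_zero (f : R -> R) (a : R) :
  (forall x, x <= a -> f x = 0) ->
  Rbar_locally m_infty (fun u => is_RInt f u a 0).
Proof.
intros H. exists a. intros u Hu. apply is_RInt_zero.
rewrite Rmin_left, Rmax_right by lra. intros x Hx. apply H; lra.
Qed.

Lemma right_tail_zero (f : R -> R) (b : R) :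
  (forall x, b <= x -> f x = 0) ->
  Rbar_locally p_infty (fun v => is_RInt f b v 0).
Proof.
intros H. exists b. intros v Hv. apply is_RInt_zero.
rewrite Rmin_left, Rmax_right by lra. intros x Hx. apply H; lra.
Qed.

(** [B] is chosen before [f], so that one bound serves both supports at all times of an interval. *)
Lemma compact_support_bound (K : R -> Prop) :
  compact K ->
  exists B, 0 < B /\ forall f : R -> R, included (support f) K ->
    forall x, B <= Rabs x -> f x = 0.
Proof.
intros HK. destruct (compact_P1 K HK) as [m [M HmM]].
exists (1 + Rabs m + Rabs M). split.
{ assert (H1 := Rabs_pos m). assert (H2 := Rabs_pos M). lra. }
intros f Hf x Hx. apply NNPP; intros Hn.
assert (HKx : K x) by (apply Hf, adherence_P1, Hn).
specialize (HmM x HKx). revert Hx.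
unfold Rabs. repeat destruct Rcase_abs; lra.
Qed.

(** The complement of a closure is open. This provides the gap between 0 and the support of
    [rho0]. *)
Lemma zero_near_outside_support (f : R -> R) (x : R) :
  ~ support f x -> exists d, 0 < d /\ forall y, Rabs (y - x) < d -> f y = 0.
Proof.
intros Hx. apply NNPP; intros Hn. apply Hx.
intros V [d Hd]. apply NNPP; intros HV. apply Hn.
exists d; split; [apply cond_pos|].
intros y Hy. apply NNPP; intros Hfy. apply HV.
exists y. split; trivial. apply Hd, Hy.
Qed.

(** * The initial profile *)

(** [- Theta0] is 1 minus the primitive of [rho0] from [- B]: it decreases from 1 to 0 and still
    equals 1 up to [d], so its integral is at least [B + d]. All [B >= B0] are allowed because the
    window is later enlarged to contain the supports. *)
Lemma initial_profile (rho0 Theta0 : R -> R) :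
  (forall x, continuous rho0 x) ->
  (forall x, 0 <= rho0 x) ->
  compact (support rho0) ->
  included (support rho0) (fun x => 0 < x) ->
  is_RInt_gen rho0 (Rbar_locally m_infty) (Rbar_locally p_infty) 1 ->
  (forall x, Theta0 x = - RInt_gen rho0 (at_point x) (Rbar_locally p_infty)) ->
  exists d B0, 0 < d < B0 /\ forall B, B0 <= B ->
    (forall x, - B <= x <= B -> 0 <= - Theta0 x <= 1) /\
    - Theta0 (- B) = 1 /\ - Theta0 B = 0 /\
    d <= RInt (fun x => - Theta0 x) (- B) B - B.
Proof.
intros Cr r0 Kr Sr Mr HT.
destruct (zero_near_outside_support rho0 0) as [d [Hd Hrd]].
{ intros H. specialize (Sr 0 H). simpl in Sr. lra. }
destruct (compact_support_bound _ Kr) as [B1 [HB1 Hr1]].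
specialize (Hr1 rho0 (fun x H => H)).
(* For [x <= 0] this is the support hypothesis, for [0 < x < d] the gap. *)
assert (Hneg : forall x, x < d -> rho0 x = 0).
{ intros x Hx. destruct (Rle_dec x 0).
  - apply NNPP; intros Hn. assert (H := Sr x (adherence_P1 _ x Hn)). simpl in H. lra.
  - apply Hrd. rewrite Rminus_0_r, Rabs_pos_eq; lra. }
exists d, (B1 + d). split; [lra|]. intros B HB.
assert (Er : forall u v, ex_RInt rho0 u v) by (intros; now apply continuous_ex_RInt).
assert (Htail : forall x, B <= x -> rho0 x = 0).
{ intros x Hx. apply Hr1. rewrite Rabs_pos_eq; lra. }
assert (Hmass : RInt rho0 (- B) B = 1).
{ rewrite <- (is_RInt_gen_unique _ _ Mr). symmetry.
  apply (is_RInt_gen_unique (V := R_CompleteNormedModule)).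
  apply is_RInt_gen_zero_tails; try apply _; trivial.
  - apply left_tail_zero. intros x Hx. apply Hneg; lra.
  - now apply right_tail_zero. }
set (P := fun x => RInt rho0 (- B) x : R).
assert (DP : forall x, is_derive P x (rho0 x)).
{ intros x. apply (is_derive_RInt (V := R_NormedModule) rho0) with (a := - B); [|apply Cr].
  exists (mkposreal 1 Rlt_0_1). intros y _.
  now apply (RInt_correct (V := R_CompleteNormedModule)). }
assert (Hq : forall x, - Theta0 x = 1 - P x).
{ intros x. rewrite HT, Ropp_involutive.
  rewrite (is_RInt_gen_unique (V := R_CompleteNormedModule) _ (RInt rho0 x B)).
  - assert (HC := RInt_Chasles rho0 (- B) x B (Er _ _) (Er _ _)).
    unfold plus in HC; cbn -[RInt] in HC. unfold P. lra.
  - apply is_RInt_gen_zero_tails; try apply _; trivial.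
    + apply (is_RInt_point (V := R_NormedModule)).
    + now apply right_tail_zero. }
assert (Pinc : forall x y, x <= y -> P x <= P y).
{ intros x y Hxy. apply (derive_ge0_nondecreasing P rho0); auto. }
assert (P0 : P (- B) = 0) 
  by exact (RInt_point (V := R_CompleteNormedModule) (- B) rho0).
assert (CP : forall x, continuous (fun x => 1 - P x) x).
{ intros x. apply (ex_derive_continuous (fun x => 1 - P x)).
  exists (0 - rho0 x). apply (is_derive_minus (V := R_NormedModule)); trivial.
  apply (is_derive_const (V := R_NormedModule)). }
rewrite (RInt_ext _ (fun x => 1 - P x)) by (intros; apply Hq).
split; [|split; [|split]].
- intros x Hx. rewrite Hq.
  assert (H1 := Pinc (- B) x ltac:(lra)). assert (H2 := Pinc x B ltac:(lra)).
  unfold P at 2 in H2. rewrite Hmass in H2. lra.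
- rewrite Hq, P0. lra.
- rewrite Hq. unfold P. rewrite Hmass. lra.
- rewrite <- (RInt_Chasles (V := R_CompleteNormedModule) (fun x => 1 - P x) (- B) d B)
    by now apply continuous_ex_RInt.
  assert (H1 : 0 <= RInt (fun x => 1 - P x) d B).
  { apply RInt_ge_0; [lra|now apply continuous_ex_RInt|].
    intros x Hx. assert (H2 := Pinc x B ltac:(lra)).
    unfold P at 2 in H2. rewrite Hmass in H2. lra. }
  rewrite (RInt_ext (fun x => 1 - P x) (fun _ => 1) (- B) d).
  + rewrite (RInt_const (V := R_CompleteNormedModule)).
    unfold plus, scal; cbn -[RInt]. unfold mult; cbn -[RInt]. lra.
  + intros x. rewrite Rmin_left, Rmax_right by lra. intros Hx.
    enough (P x = 0) by (simpl; lra).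
    apply is_RInt_unique, is_RInt_zero.
    rewrite Rmin_left, Rmax_right by lra. intros y Hy. apply Hneg; lra.
Qed.

(** * From a global solution to the contradiction *)

Lemma cky_U_compact_support (Omega : R -> R -> R) (B xi t : R) :
  (forall a b, ex_RInt (fun y => Omega y t) a b) ->
  (forall y, B <= Rabs y -> Omega y t = 0) -> 0 < B ->
  cky_U Omega xi t = 2 / PI * RInt (fun y => Omega y t) (- B) xi.
Proof.
intros Hex H0 HB. unfold cky_U. f_equal.
apply (is_RInt_gen_unique (V := R_CompleteNormedModule)).
apply is_RInt_gen_zero_tails; try apply _; trivial.
- apply left_tail_zero. intros x Hx. apply H0. rewrite Rabs_left1; lra.
- apply (is_RInt_point (V := R_NormedModule)).
Qed.

Theorem theorem3p3 (rho0 Theta0 Omega0 : R -> R)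
  (rho0_smooth : smooth rho0)
  (rho0_ge0 : forall xi, 0 <= rho0 xi)
  (rho0_compact : compact (support rho0))
  (rho0_support : included (support rho0) (fun xi => 0 < xi))
  (rho0_mass :
    is_RInt_gen rho0 (Rbar_locally m_infty) (Rbar_locally p_infty) 1)
  (Theta0_def : forall xi,
    Theta0 xi = - RInt_gen rho0 (at_point xi) (Rbar_locally p_infty))
  (Omega0_smooth : smooth Omega0)
  (Omega0_ge0 : forall xi, 0 <= Omega0 xi)
  (Omega0_compact : compact (support Omega0)) :
  ~ exists Omega Theta : R -> R -> R,
      cky_smooth_solution (fun t => 0 <= t) Omega0 Theta0 Omega Theta.
Proof.
intros [Omega [Theta [SO ST EO ET IO IT Hsupp]]].
destruct (initial_profile rho0 Theta0) as [d [B0 [HdB HB0]]]; trivial.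
{ intros x. apply (ex_derive_continuous rho0). exact (rho0_smooth 1%nat x). }
assert (HPI := PI_RGT_0).
set (c := 2 / PI). assert (Hc : 0 < c) by (apply Rdiv_lt_0_compat; lra).
(* [c / 2] is the constant of the convexity estimate. [T] is fixed first because [K], and with it
   [B], depends on [T]. *)
destruct (quadratic_second_derivative_blowup (c / 2) d) as [T [HT blowup]]; [lra..|].
destruct (Hsupp 0 T) as [K [HK HKs]]; [intros; lra|].
destruct (compact_support_bound K HK) as [B1 [HB1 HKB]].
set (B := Rmax B0 B1).
assert (HB : B0 <= B) by apply Rmax_l.
assert (HBB : B1 <= B) by apply Rmax_r.
assert (HBabs : B1 <= Rabs B /\ B1 <= Rabs (- B)).
{ rewrite Rabs_Ropp, Rabs_pos_eq; lra. }
destruct (HB0 B HB) as [HQ0 [HQl [HQr HQint]]].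
(* [W] and [P] agree with [Omega] and [Theta] for [t >= 0] and have two-sided time derivatives
   everywhere. *)
destruct (C1_plane_extension Omega (SO 1%nat)) as [W [Wx [Wt [CW HW]]]].
destruct (C1_plane_extension Theta (ST 1%nat)) as [P [Px [Pt [CP HP]]]].
assert (CQ : C1_plane (fun x t => - P x t) (fun x t => - Px x t) (fun x t => - Pt x t)).
{ destruct CP. split; intros; auto using continuity_2d_pt_opp;
    apply (is_derive_opp (V := R_NormedModule)); auto. }
assert (HO0 : forall x t, 0 <= t <= T -> B1 <= Rabs x -> Omega x t = 0).
{ intros x t Ht Hx. exact (HKB _ (proj1 (HKs t Ht)) x Hx). }
assert (Hr0 : forall x t, 0 <= t <= T -> B1 <= Rabs x -> Px x t = 0).
{ intros x t Ht Hx. destruct (HP x t) as [_ [-> _]]; [lra|].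
  exact (HKB _ (proj2 (HKs t Ht)) x Hx). }
assert (HU : forall x t, 0 <= t <= T ->
  cky_U Omega x t = c * RInt (fun y => W y t) (- B) x).
{ intros x t Ht.
  assert (HWO : forall y, W y t = Omega y t) by (intros y; apply HW; lra).
  rewrite (RInt_ext (fun y => W y t) (fun y => Omega y t)) by (intros; apply HWO).
  apply cky_U_compact_support; [| |lra].
  - intros u v. apply (ex_RInt_ext (fun y => W y t)); [intros; apply HWO|].
    apply ex_RInt_slice. intros y; apply (C1_cont _ _ _ CW).
  - intros y Hy. apply HO0; trivial; lra. }
assert (EP : forall x t, 0 <= t <= T ->
  Pt x t = - (c * RInt (fun y => W y t) (- B) x * Px x t)).
{ intros x t Ht. destruct (ET x t) as [Tt [HTt HE]]; [lra|].
  destruct (HP x t) as [_ [-> HPt]]; [lra|].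
  rewrite <- HU, (is_derive_on_ge0_unique _ _ _ _ (proj1 Ht) HPt HTt) by trivial.
  lra. }
(* [rho] vanishes at [x], so [Theta] is stationary there *)
assert (Hstat : forall x t, 0 <= t <= T -> B1 <= Rabs x -> P x t = Theta0 x).
{ intros x t Ht Hx. rewrite <- IT, <- (proj1 (HP x 0 ltac:(lra))).
  assert (Hz : forall s, 0 <= s <= T -> Pt x s = 0).
  { intros s Hs. rewrite EP, Hr0 by trivial. ring. }
  apply Rle_antisym.
  - apply Ropp_le_cancel.
    apply (derive_ge0_nondecreasing (fun s => - P x s) (fun s => - Pt x s)); [lra| |].
    + intros s _. apply (C1_dt _ _ _ CQ).
    + intros s Hs. rewrite Hz; lra.
  - apply (derive_ge0_nondecreasing (P x) (Pt x)); [lra| |].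
    + intros s _. apply (C1_dt _ _ _ CP).
    + intros s Hs. rewrite Hz; lra. }
assert (HP0 : forall x, P x 0 = Theta0 x).
{ intros x. rewrite <- IT. apply HP; lra. }
(* With [Q = - P], the forcing [exp x * Theta_xi] takes the form [- exp x * Q_x]. *)
destruct (cky_functional_convex c B T W Wx Wt (fun x t => - P x t)
  (fun x t => - Px x t) (fun x t => - Pt x t)) as [p [a [Hp0 Hpa]]]; trivial; try lra.
- intros t Ht. split; rewrite (proj1 (HW _ t (proj1 Ht))); apply HO0; tauto.
- intros t Ht. split; rewrite Hstat; tauto.
- intros x _. rewrite (proj1 (HW x 0 (Rle_refl 0))), IO. apply Omega0_ge0.
- intros x Hx. rewrite HP0. now apply HQ0.
- intros x t Hx Ht. destruct (EO x t) as [Ot [HOt HE]]; [lra|].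
  destruct (HP x t) as [_ [-> _]]; [lra|].
  destruct (HW x t) as [_ [-> HWt]]; [lra|].
  rewrite <- HU, (is_derive_on_ge0_unique _ _ _ _ (proj1 Ht) HWt HOt) by trivial.
  lra.
- intros x t Hx Ht. rewrite EP by trivial. ring.
- set (y := fun t => RInt (fun x => - P x t) (- B) B) in *.
  assert (Hy0 : d <= y 0 - B).
  { unfold y. rewrite (RInt_ext _ (fun x => - Theta0 x)); trivial.
    intros x _. now rewrite HP0. }
  (* Shifting by [y 0] gives [v 0 = 0]. As [y 0 - B >= d], the condition [v >= 0] implies both
     [y >= B] and [y - B >= v + d]. *)
  apply (blowup (fun t => y t - y 0) p a); trivial.
  + ring.
  + intros t Ht. rewrite <- (Rminus_0_r (p t)).
    apply (is_derive_minus (V := R_NormedModule)); [now apply Hpa|].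
    apply (is_derive_const (V := R_NormedModule)).
  + intros t Ht. now apply Hpa.
  + intros t Ht. now apply Hpa.
  + intros t Ht Hv. destruct (Hpa t Ht) as [_ [_ [_ H]]].
    assert (HyB : B <= y t) by lra.
    apply Rle_trans with (2 := H HyB). apply Rmult_le_compat_l; [lra|].
    apply pow_incr. fold (y t). lra.
Qed.
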